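(* Let $p,N\ge 1$, let $Y_1,\dots,Y_N\in\mathbb{R}^p$ and $W_1,\dots,W_N\in\mathbb{R}_{>0}$, and let $Y^{W}=\left(\frac{1}{\sqrt{W_1}}Y_1,\dots,\frac{1}{\sqrt{W_N}}Y_N\right)\in\mathbb{R}^{pN}$. Let $G\subseteq GL(\mathbb{R}^p)$ be a subgroup that is closed under non-zero (real) scalar multiples, and let $G_{SL}^{\pm}$ be the subgroup of $G$ consisting of the matrices with determinant $1$ or $-1$. Then maximizing $\ell_c(A^\top A)$ over $A\in G$ is equivalent to the following double minimization: $$\sup_{A\in G}\ell_c(A^\top A)\;=\;-\inf_{\alpha\in\mathbb{R}_{>0}}\left(\alpha\left(\inf_{B\in G_{SL}^{\pm}}\|B\cdot Y^{W}\|^2\right)-pN\log\alpha\right)$$ (as an equality of extended real numbers). The MLEs, if they exist, are the matrices $\alpha B^\top B$, where $B\in G_{SL}^{\pm}$ minimizes the norm $\|B\cdot Y^{W}\|$ under the action of $G_{SL}^{\pm}$ on $\mathbb{R}^{pN}$ and $\alpha\in\mathbb{R}_{>0}$ is the unique value minimizing the outer infimum.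
   Context: $(Y_1,\dots,Y_N,W_1,\dots,W_N)$ is a (realized) sample from the joint distribution of $(Y,W)$, where $Y=\sqrt{W}Z$, $W\sim \mathrm{Exp}(1)$ and $Z\sim\mathcal{N}_p(0,\Sigma)$ are independent; thus $Y$ has the multivariate symmetric Laplace distribution with positive definite scale matrix $\Sigma$. The concentration matrix is $\Psi=\Sigma^{-1}$. The Laplace group model defined by $G$ is $\mathcal{L}_G=\{A^\top A\mid A\in G\}$, a set of positive definite matrices $\Psi$. The complete-data log-likelihood function (up to an additive constant and a positive factor) is $$\ell_c(\Psi)=N\log|\Psi|-\sum_{i=1}^N\frac{1}{W_i}\operatorname{tr}(\Psi Y_iY_i^\top),$$ where $|\cdot|$ is the determinant. An MLE (given $Y^W$, equivalently given the sample) is a matrix $\hat\Psi\in\mathcal{L}_G$ maximizing $\ell_c$ over $\mathcal{L}_G$. A matrix $A\in GL(\mathbb{R}^p)$ acts on $\mathbb{R}^{pN}$ diagonally: $A\cdot Y^W=\left(\frac{1}{\sqrt{W_1}}AY_1,\dots,\frac{1}{\sqrt{W_N}}AY_N\right)$. $\|\cdot\|$ is the Euclidean norm. *)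

(* Defs.v *)
From mathcomp Require Import all_boot all_order all_algebra.
From mathcomp Require Import boolp classical_sets reals ereal exp.

Set Implicit Arguments.
Unset Strict Implicit.
Unset Printing Implicit Defensive.

Import Order.TTheory GRing.Theory Num.Theory.

Local Open Scope classical_set_scope.
Local Open Scope ring_scope.

(* Matrix groups are sets of matrices: MathComp's general linear groups exist
   only over finite rings. *)
Record is_GL_subgroup (R : realType) (p : nat) (G : set 'M[R]_p) : Prop := {
  GL_subgroup_unit : forall A, G A -> A \in unitmx ;
  GL_subgroup_one : G 1%:M ;
  GL_subgroup_mul : forall A B, G A -> G B -> G (A *m B) ;
  GL_subgroup_inv : forall A, G A -> G (invmx A) }.

Definition closed_under_nonzero_scaling (R : realType) (p : nat)
    (G : set 'M[R]_p) : Prop :=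
  forall (c : R) (A : 'M[R]_p), c != 0 -> G A -> G (c *: A).

Definition SLpm (R : realType) (p : nat) (G : set 'M[R]_p) : set 'M[R]_p :=
  [set A | G A /\ (\det A = 1 \/ \det A = -1)].

Definition laplace_group_model (R : realType) (p : nat) (G : set 'M[R]_p) :
    set 'M[R]_p :=
  [set A^T *m A | A in G].

Definition loglik (R : realType) (p N : nat) (Y : 'I_N -> 'cV[R]_p)
    (W : 'I_N -> R) (Psi : 'M[R]_p) : R :=
  N%:R * ln (\det Psi)
    - \sum_(i < N) (W i)^-1 * \tr (Psi *m (Y i *m (Y i)^T)).

Definition is_MLE (R : realType) (p N : nat) (G : set 'M[R]_p)
    (Y : 'I_N -> 'cV[R]_p) (W : 'I_N -> R) (Psi : 'M[R]_p) : Prop :=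
  laplace_group_model G Psi /\
  forall Phi, laplace_group_model G Phi -> loglik Y W Phi <= loglik Y W Psi.

(* R^(pN) is represented as the N-tuples of column vectors of R^p. *)
Definition scaled_sample (R : realType) (p N : nat) (Y : 'I_N -> 'cV[R]_p)
    (W : 'I_N -> R) : 'I_N -> 'cV[R]_p :=
  fun i => (Num.sqrt (W i))^-1 *: Y i.

Definition diag_act (R : realType) (p N : nat) (A : 'M[R]_p)
    (y : 'I_N -> 'cV[R]_p) : 'I_N -> 'cV[R]_p :=
  fun i => A *m y i.

(* The library norm `|_| on matrices is the sup norm, hence this definition. *)
Definition euclidean_norm (R : realType) (p N : nat) (y : 'I_N -> 'cV[R]_p) :
    R :=
  Num.sqrt (\sum_(i < N) \sum_(j < p) (y i j 0) ^+ 2).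

Definition minimizes_norm (R : realType) (p N : nat) (H : set 'M[R]_p)
    (y : 'I_N -> 'cV[R]_p) (B : 'M[R]_p) : Prop :=
  H B /\
  forall B', H B' -> euclidean_norm (diag_act B y) <=
                     euclidean_norm (diag_act B' y).

Definition inner_inf (R : realType) (p N : nat) (H : set 'M[R]_p)
    (y : 'I_N -> 'cV[R]_p) : \bar R :=
  ereal_inf [set ((euclidean_norm (diag_act B y)) ^+ 2)%:E | B in H].

Definition outer_objective (R : realType) (p N : nat) (H : set 'M[R]_p)
    (y : 'I_N -> 'cV[R]_p) (alpha : R) : \bar R :=
  (alpha%:E * inner_inf H y - ((p * N)%:R * ln alpha)%:E)%E.

Definition minimizes_outer (R : realType) (p N : nat) (H : set 'M[R]_p)
    (y : 'I_N -> 'cV[R]_p) (alpha : R) : Prop :=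
  0 < alpha /\
  forall beta : R, 0 < beta ->
    (outer_objective H y alpha <= outer_objective H y beta)%E.

(* Main.v *)
Require Import Defs.
From mathcomp Require Import all_boot all_order all_algebra.
From mathcomp Require Import boolp classical_sets reals ereal exp.
From mathcomp Require Import ring lra.

Set Implicit Arguments.
Unset Strict Implicit.
Unset Printing Implicit Defensive.

Import Order.TTheory GRing.Theory Num.Theory.

Local Open Scope classical_set_scope.
Local Open Scope ring_scope.

(** Every [A] in [G] is [sqrt alpha *: B] with [alpha = `|det A| ^ (2 / p)] and
    [B] of determinant [1] or [-1], because [G] is stable under scaling, and
    conversely every such multiple lies in [G]; thus the model consists of the
    matrices [alpha *: (B^T *m B)] ([laplace_group_modelE]).  In these
    coordinates the determinant sees only [alpha], and the trace term is a
    squared norm, homogeneous of degree 2 in the group element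
    ([loglik_polar]):

      loglik (alpha B^T B) = - (alpha q(B) - p N ln alpha),
      where q(B) is the squared norm of B acting on the scaled sample.

    Maximizing the likelihood is therefore minimizing the right-hand function
    over independent variables [alpha] and [B].  As [alpha > 0], the infimum
    over [B] for fixed [alpha] replaces [q(B)] by its infimum [m], which is a
    nonnegative real ([inner_inf_fin]); this gives the equality of the extremal
    values.  A joint minimizer is a pair of a minimizer [B] of [q], so that
    [m = q(B)], and of a minimizer [alpha] of [alpha m - p N ln alpha], and
    the latter is unique ([outer_minimizer_unique]). *)

(** * Squared norms and the likelihood *)

Lemma sqr_euclidean_norm (R : realType) (p N : nat) (y : 'I_N -> 'cV[R]_p) :
  euclidean_norm y ^+ 2 = \sum_(i < N) \sum_(j < p) y i j 0 ^+ 2.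
Proof.
rewrite sqr_sqrtr //; apply: sumr_ge0 => i _; apply: sumr_ge0 => j _.
exact: sqr_ge0.
Qed.

Lemma sqr_norm_diag_actZ (R : realType) (p N : nat) (c : R) (B : 'M[R]_p)
    (y : 'I_N -> 'cV[R]_p) :
  euclidean_norm (diag_act (c *: B) y) ^+ 2 =
  c ^+ 2 * euclidean_norm (diag_act B y) ^+ 2.
Proof.
rewrite !sqr_euclidean_norm mulr_sumr; apply: eq_bigr => i _.
rewrite mulr_sumr; apply: eq_bigr => j _.
by rewrite /diag_act -scalemxAl mxE exprMn.
Qed.

Lemma mxtrace_gram (R : realType) (p : nat) (A : 'M[R]_p) (v : 'cV[R]_p) :
  \tr ((A^T *m A) *m (v *m v^T)) = \sum_(j < p) (A *m v) j 0 ^+ 2.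
Proof.
rewrite mulmxA mxtrace_mulC !mulmxA -trmx_mul -mulmxA.
rewrite /mxtrace big_ord1 mxE; apply: eq_bigr => j _.
by rewrite mxE expr2.
Qed.

(** Dividing [Y i] by the square root of [W i] puts the weight [(W i)^-1] inside
    the square, so that the data enter only through a Euclidean norm. *)
Lemma trace_term_sqr_norm (R : realType) (p N : nat) (Y : 'I_N -> 'cV[R]_p)
    (W : 'I_N -> R) (hW : forall i, 0 < W i) (A : 'M[R]_p) :
  \sum_(i < N) (W i)^-1 * \tr ((A^T *m A) *m (Y i *m (Y i)^T)) =
  euclidean_norm (diag_act A (scaled_sample Y W)) ^+ 2.
Proof.
rewrite sqr_euclidean_norm; apply: eq_bigr => i _.
rewrite mxtrace_gram mulr_sumr; apply: eq_bigr => j _.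
rewrite /diag_act /scaled_sample -scalemxAr [in RHS]mxE exprMn exprVn.
by rewrite sqr_sqrtr // ltW.
Qed.

Lemma det_gram_SLpm (R : realType) (p : nat) (G : set 'M[R]_p) (B : 'M[R]_p) :
  SLpm G B -> \det (B^T *m B) = 1.
Proof.
by case=> _ dB; rewrite det_mulmx det_tr; case: dB => ->; rewrite ?mulrNN mulr1.
Qed.

Lemma gram_sqrtZ (R : realType) (p : nat) (a : R) (B : 'M[R]_p) :
  0 < a ->
  (Num.sqrt a *: B)^T *m (Num.sqrt a *: B) = a *: (B^T *m B).
Proof.
move=> a0; rewrite [(_ *: _)^T]linearZ /= -scalemxAl -scalemxAr scalerA -expr2.
by rewrite sqr_sqrtr // ltW.
Qed.

(** The variables separate because [B] has determinant [1] or [-1], which leaves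
    [a ^+ p] as the determinant; the factor [a] of the norm comes from acting
    with [Num.sqrt a *: B]. *)
Lemma loglik_polar (R : realType) (p N : nat) (Y : 'I_N -> 'cV[R]_p)
    (W : 'I_N -> R) (hW : forall i, 0 < W i) (G : set 'M[R]_p)
    (a : R) (B : 'M[R]_p) :
  0 < a -> SLpm G B ->
  loglik Y W (a *: (B^T *m B)) =
  - (a * euclidean_norm (diag_act B (scaled_sample Y W)) ^+ 2
     - (p * N)%:R * ln a).
Proof.
move=> a0 GB; rewrite /loglik detZ (det_gram_SLpm GB) mulr1.
rewrite -gram_sqrtZ // trace_term_sqr_norm // sqr_norm_diag_actZ.
rewrite sqr_sqrtr ?ltW // lnXn // natrM -mulr_natl; ring.
Qed.

(** * Polar coordinates on the model *)

(** [A] is divided by the [p]-th root [c] of [`|det A|], because scaling by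
    [c^-1] multiplies the determinant by [c ^- p]; then [a = c ^+ 2]. *)
Lemma laplace_group_modelE (R : realType) (p : nat) (hp : (0 < p)%N)
    (G : set 'M[R]_p) (hG : is_GL_subgroup G)
    (hGs : closed_under_nonzero_scaling G) (Psi : 'M[R]_p) :
  laplace_group_model G Psi <->
  exists (a : R) (B : 'M[R]_p), [/\ 0 < a, SLpm G B & Psi = a *: (B^T *m B)].
Proof.
split=> [[A GA <-]|[a [B [a0 [GB dB] ->]]]]; last first.
  exists (Num.sqrt a *: B); last exact: gram_sqrtZ.
  by apply: hGs => //; rewrite gt_eqF // sqrtr_gt0.
have dA : 0 < `|\det A|.
  by rewrite normr_gt0 -unitfE -unitmxE; apply: GL_subgroup_unit GA.
pose c := `|\det A| `^ p%:R^-1.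
have c0 : 0 < c by exact: powR_gt0.
have cp : c ^+ p = `|\det A|.
  rewrite -powR_mulrn ?ltW // -powRrM mulVf ?pnatr_eq0 -?lt0n //.
  by rewrite powRr1 // ltW.
exists (c ^+ 2), (c^-1 *: A); split; first exact: exprn_gt0.
- split; first by apply: hGs => //; rewrite invr_eq0 gt_eqF.
  rewrite detZ exprVn cp.
  have [d0|d0] := ltP 0 (\det A).
    by left; rewrite gtr0_norm // mulVf // gt_eqF.
  right; rewrite ler0_norm // invrN mulNr mulVf //.
  by rewrite -normr_gt0.
- rewrite [(_ *: _)^T]linearZ /= -scalemxAl -scalemxAr !scalerA.
  by rewrite expr2 mulfK ?mulfV ?scale1r // gt_eqF.
Qed.

Lemma SLpm_one (R : realType) (p : nat) (G : set 'M[R]_p) :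
  is_GL_subgroup G -> SLpm G 1%:M.
Proof. by move=> hG; split; [exact: GL_subgroup_one | left; exact: det1]. Qed.

(** * The inner and the outer minimization *)

Lemma inner_inf_fin (R : realType) (p N : nat) (H : set 'M[R]_p)
    (y : 'I_N -> 'cV[R]_p) :
  H !=set0 -> exists2 m : R, 0 <= m & inner_inf H y = m%:E.
Proof.
case=> B HB.
have m_ge0 : (0%:E <= inner_inf H y)%E.
  by apply/ereal_infP => _ [C _ <-]; rewrite lee_fin sqr_ge0.
have m_le : (inner_inf H y <= (euclidean_norm (diag_act B y) ^+ 2)%:E)%E.
  by apply: ereal_inf_lbound; exists B.
move: m_ge0 m_le; case: (inner_inf H y) => [m||] //= m_ge0 _.
by exists m.
Qed.

Lemma inner_inf_lb (R : realType) (p N : nat) (H : set 'M[R]_p)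
    (y : 'I_N -> 'cV[R]_p) (m : R) (B : 'M[R]_p) :
  inner_inf H y = m%:E -> H B -> m <= euclidean_norm (diag_act B y) ^+ 2.
Proof.
by move=> mE HB; rewrite -lee_fin -mE; apply: ereal_inf_lbound; exists B.
Qed.

Lemma inner_inf_glb (R : realType) (p N : nat) (H : set 'M[R]_p)
    (y : 'I_N -> 'cV[R]_p) (m r : R) :
  inner_inf H y = m%:E ->
  (forall B, H B -> r <= euclidean_norm (diag_act B y) ^+ 2) -> r <= m.
Proof.
move=> mE rlb; rewrite -lee_fin -mE; apply/ereal_infP => _ [B HB <-].
by rewrite lee_fin rlb.
Qed.

Lemma inner_inf_attained (R : realType) (p N : nat) (H : set 'M[R]_p)
    (y : 'I_N -> 'cV[R]_p) (m : R) (B : 'M[R]_p) :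
  inner_inf H y = m%:E -> minimizes_norm H y B ->
  euclidean_norm (diag_act B y) ^+ 2 = m.
Proof.
move=> mE [HB minB]; apply/eqP; rewrite eq_le (inner_inf_lb mE) //.
rewrite andbT; apply: (inner_inf_glb mE) => C HC.
by rewrite ler_sqr ?nnegrE ?sqrtr_ge0 // minB.
Qed.

Lemma outer_objectiveE (R : realType) (p N : nat) (H : set 'M[R]_p)
    (y : 'I_N -> 'cV[R]_p) (m a : R) :
  inner_inf H y = m%:E ->
  outer_objective H y a = (a * m - (p * N)%:R * ln a)%:E.
Proof. by move=> mE; rewrite /outer_objective mE. Qed.

Lemma minimizes_outerE (R : realType) (p N : nat) (H : set 'M[R]_p)
    (y : 'I_N -> 'cV[R]_p) (m a : R) :
  inner_inf H y = m%:E ->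
  minimizes_outer H y a <->
  0 < a /\ forall b, 0 < b ->
    a * m - (p * N)%:R * ln a <= b * m - (p * N)%:R * ln b.
Proof.
move=> mE; split=> -[a0 mina]; split=> // b b0; move: (mina b b0);
  by rewrite !(outer_objectiveE _ mE) lee_fin.
Qed.

(** The slope [m] is positive, since otherwise doubling [a] would lower the
    value.  At the geometric mean of two minimizers the logarithmic term is
    the average of the two, whereas the linear term is smaller than the average
    unless the minimizers agree. *)
Lemma outer_minimizer_unique (R : realType) (m K a b : R) :
  0 <= m -> 0 < K -> 0 < a -> 0 < b ->
  (forall c, 0 < c -> a * m - K * ln a <= c * m - K * ln c) ->
  (forall c, 0 < c -> b * m - K * ln b <= c * m - K * ln c) ->
  a = b.
Proof.
move=> m0 K0 a0 b0 mina minb.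
have mpos : 0 < m.
  rewrite lt_neqAle m0 andbT eq_sym; apply/eqP => mz.
  have := mina (2 * a) (mulr_gt0 (ltr0Sn R 1) a0).
  rewrite mz !mulr0 lnM ?posrE // mulrDr.
  have : 0 < K * ln 2 by rewrite mulr_gt0 // ln_gt0 // ltr1n.
  lra.
pose s := Num.sqrt a; pose t := Num.sqrt b.
have s0 : 0 < s by rewrite sqrtr_gt0.
have t0 : 0 < t by rewrite sqrtr_gt0.
have aE : a = s ^+ 2 by rewrite sqr_sqrtr // ltW.
have bE : b = t ^+ 2 by rewrite sqr_sqrtr // ltW.
have := minb (s * t) (mulr_gt0 s0 t0).
have := mina (s * t) (mulr_gt0 s0 t0).
rewrite aE bE !lnXn // lnM ?posrE // -!(mulr_natl (ln _)) => h1 h2.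
have : m * (s - t) ^+ 2 <= 0 by lra.
rewrite pmulr_rle0 // => st.
have : (s - t) ^+ 2 == 0 by rewrite eq_le st sqr_ge0.
by rewrite sqrf_eq0 subr_eq0 => /eqP ->.
Qed.

(** * The double minimization *)

Theorem theorem3p5 (R : realType) (p N : nat) (hp : (0 < p)%N) (hN : (0 < N)%N)
    (Y : 'I_N -> 'cV[R]_p) (W : 'I_N -> R) (hW : forall i, 0 < W i)
    (G : set 'M[R]_p) (hG : is_GL_subgroup G)
    (hGs : closed_under_nonzero_scaling G) :
  let YW := scaled_sample Y W in
  [/\ ereal_sup [set (loglik Y W (A^T *m A))%:E | A in G] =
      (- ereal_inf [set outer_objective (SLpm G) YW alpha |
                    alpha in [set a : R | (0 < a)%R]])%E,
      (exists Psi, is_MLE G Y W Psi) ->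
        exists! alpha : R, minimizes_outer (SLpm G) YW alpha
    & forall Psi, is_MLE G Y W Psi <->
        exists (alpha : R) (B : 'M[R]_p),
          [/\ minimizes_outer (SLpm G) YW alpha,
              minimizes_norm (SLpm G) YW B
            & Psi = alpha *: (B^T *m B)] ].
Proof.
move=> YW.
have K0 : 0 < (p * N)%:R :> R by rewrite ltr0n muln_gt0 hp.
have [m m0 mE] := inner_inf_fin YW (ex_intro _ _ (SLpm_one hG)).
have modelE := laplace_group_modelE hp hG hGs.
have likE := loglik_polar Y hW (G := G).
have outE a := outer_objectiveE a mE.
have minE a := minimizes_outerE a mE.
have lb B := inner_inf_lb (B := B) mE.
have mle_min Psi : is_MLE G Y W Psi -> exists (alpha : R) (B : 'M[R]_p),
    [/\ minimizes_outer (SLpm G) YW alpha, minimizes_norm (SLpm G) YW B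
      & Psi = alpha *: (B^T *m B)].
  case=> /modelE[a [B [a0 HB ->]]] maxB; exists a, B.
  have minf b C : 0 < b -> SLpm G C ->
      a * euclidean_norm (diag_act B YW) ^+ 2 - (p * N)%:R * ln a <=
      b * euclidean_norm (diag_act C YW) ^+ 2 - (p * N)%:R * ln b.
    move=> b0 HC; rewrite -lerN2 -!likE //; apply: maxB; apply/modelE.
    by exists b, C.
  have minB : minimizes_norm (SLpm G) YW B.
    split=> // C HC; rewrite -ler_sqr ?nnegrE ?sqrtr_ge0 //.
    by rewrite -(ler_pM2l a0); have := minf a C a0 HC; rewrite lerD2r.
  split=> //; apply/minE; split=> // b b0.
  by rewrite -(inner_inf_attained mE minB) minf.
split.
- apply/eqP; rewrite eq_le; apply/andP; split.
    apply/ereal_supP => _ [A GA <-].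
    have /modelE[a [B [a0 HB ->]]] : laplace_group_model G (A^T *m A).
      by exists A.
    rewrite likE // EFinN leeN2.
    apply: (@le_trans _ _ (outer_objective (SLpm G) YW a)).
      by apply: ereal_inf_lbound; exists a.
    by rewrite outE lee_fin lerD2r ler_pM2l // lb.
  rewrite leeNl; apply/ereal_infP => _ [a /= a0 <-]; rewrite outE.
  have sup_ub B : SLpm G B ->
      ((- (a * euclidean_norm (diag_act B YW) ^+ 2 - (p * N)%:R * ln a))%:E <=
       ereal_sup [set (loglik Y W (A^T *m A))%:E | A in G])%E.
    move=> HB; rewrite -likE //; apply: ereal_sup_ubound.
    have [A GA AE] : laplace_group_model G (a *: (B^T *m B)).
      by apply/modelE; exists a, B.
    by exists A => //; rewrite AE.
  move: sup_ub; case: (ereal_sup _) => [r||] sup_ub; last 2 first.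
  + by rewrite leNye.
  + by have := sup_ub _ (SLpm_one hG).
  (* For real [r] the bound on [q(B)] is solved for [q(B)], so that it passes
     to the infimum over [B]. *)
  have : ((p * N)%:R * ln a - r) / a <= m.
    apply: (inner_inf_glb mE) => B HB.
    rewrite ler_pdivrMr // mulrC.
    by have := sup_ub B HB; rewrite lee_fin; lra.
  by rewrite ler_pdivrMr // -EFinN lee_fin; lra.
- case=> Psi /mle_min[a [_ [mina _ _]]]; exists a; split=> // b /minE[b0 minb].
  have /minE[a0 mina'] := mina.
  exact: (outer_minimizer_unique m0 K0).
- move=> Psi; split; first exact: mle_min.
  case=> a [B [/minE[a0 mina] minB ->]].
  split; first by apply/modelE; exists a, B; case: minB.
  move=> Phi /modelE[b [C [b0 HC ->]]]; have [HB _] := minB.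
  rewrite !likE // lerN2 (inner_inf_attained mE minB).
  by apply: (le_trans (mina b b0)); rewrite lerD2r ler_pM2l // lb.
Qed.
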